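(* Let $v,w$ be weights on $\mathbb{R}$. The operator $T_0$ is bounded from $L^2(w^{-1})$ to $L^2(v)$ if and only if there is a constant $C<\infty$ such that (1) for every $J\in\mathcal{D}$, $\displaystyle\frac1{|J|}\int_J\Bigl(\sum_{I\in\mathcal{D},\,I\subset J}\frac1{|I|}\chi_I\langle w\rangle_I\alpha_I\Bigr)^2 v\,dx\le C\langle w\rangle_J$; (2) for every $J\in\mathcal{D}$, $\displaystyle\frac1{|J|}\int_J\Bigl(\sum_{I\in\mathcal{D},\,I\subset J}\frac1{|I|}\chi_I\langle v\rangle_I\alpha_I\Bigr)^2 w\,dx\le C\langle v\rangle_J$.
   Context: $\mathcal{D}$ is the set of dyadic intervals of $\mathbb{R}$; for $I\in\mathcal{D}$, $I_-$ and $I_+$ are its left and right halves, $|I|$ its length, $\chi_I$ its characteristic function, and $\langle f\rangle_I=\frac1{|I|}\int_I f\,dx$. The inclusion $I\subset J$ allows $I=J$. A weight is a locally integrable function on $\mathbb{R}$ that is positive almost everywhere; for a positive function $\omega$, $L^2(\omega)$ has norm $(\int|f|^2\omega\,dx)^{1/2}$. For $I\in\mathcal{D}$ put $$\alpha_I=\left|\frac{\langle v\rangle_{I_-}-\langle v\rangle_{I_+}}{\langle v\rangle_I}\right|\left|\frac{\langle w\rangle_{I_-}-\langle w\rangle_{I_+}}{\langle w\rangle_I}\right||I|,$$ and let $T_0f=\sum_{I\in\mathcal{D}}\frac1{|I|}\langle f\rangle_I\,\alpha_I\,\chi_I$, i.e. the integral operator with the nonnegative kernel $k(x,y)=\sum_{I\in\mathcal{D}}|I|^{-2}\chi_I(x)\chi_I(y)\alpha_I$.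 *)

(* Defs.v *)
From mathcomp Require Import all_boot all_order all_algebra.
From mathcomp Require Import lra.
From mathcomp Require Import all_classical all_reals all_analysis measurable_realfun.

Set Implicit Arguments.
Unset Strict Implicit.
Unset Printing Implicit Defensive.
Import Order.TTheory GRing.Theory Num.Theory.
Import numFieldNormedType.Exports.

Local Open Scope classical_set_scope.
Local Open Scope ring_scope.

(* The pair (n, k) stands for the dyadic interval [k 2^n, (k + 1) 2^n[; this
   indexing is one-to-one, see dyadic_set_inj. *)
Definition dyadic : Type := (int * int)%type.

Definition dyadic_length {R : realType} (I : dyadic) : R := 2 ^ I.1.

Definition dyadic_set {R : realType} (I : dyadic) : set R :=
  `[I.2%:~R * dyadic_length I, (I.2 + 1)%:~R * dyadic_length I[.

Definition dyadic_left (I : dyadic) : dyadic := (I.1 - 1, I.2 * 2).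

Definition dyadic_right (I : dyadic) : dyadic := (I.1 - 1, I.2 * 2 + 1).

Lemma dyadic_length_gt0 {R : realType} (I : dyadic) :
  0 < dyadic_length I :> R.
Proof. by rewrite /dyadic_length exprz_gt0. Qed.

Lemma dyadic_length_half {R : realType} (n k : int) :
  dyadic_length (n - 1, k) = dyadic_length (n, k) / 2 :> R.
Proof. by rewrite /dyadic_length /= expfzDr. Qed.

Lemma dyadic_set_halves {R : realType} (I : dyadic) :
  dyadic_set I =
    dyadic_set (dyadic_left I) `|` dyadic_set (dyadic_right I) :> set R.
Proof.
case: I => n k; rewrite /dyadic_left /dyadic_right /dyadic_set /=.
rewrite !dyadic_length_half /dyadic_length /=.
have L0 : (0 : R) < 2 ^ n by rewrite exprz_gt0.
move: (2 ^ n) L0 => L L0.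
rewrite !rmorphD !rmorphM /=.
apply/seteqP; split => x /=; rewrite !in_itv /=.
- move=> /andP[ax xb].
  have [lt|ge] := ltP x ((k%:~R * 2%:~R + 1%:~R) * (L / 2)).
    left; apply/andP; split; lra.
  right; apply/andP; split; lra.
- by case=> /andP[ax xb]; apply/andP; split; lra.
Qed.

Lemma lebesgue_measure_dyadic_set {R : realType} (I : dyadic) :
  lebesgue_measure (dyadic_set I : set R) = (dyadic_length I)%:E.
Proof.
have L0 := @dyadic_length_gt0 R I.
rewrite /dyadic_set lebesgue_measure_itv /= lte_fin ltr_pM2r// ltr_int.
rewrite ltrDl ltr01 -EFinB; congr EFin.
by rewrite -mulrBl rmorphD /= addrAC subrr add0r mul1r.
Qed.

Lemma dyadic_set_inj {R : realType} :
  injective (dyadic_set : dyadic -> set R).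
Proof.
move=> I J eqIJ.
have eqL : dyadic_length I = dyadic_length J :> R.
  by apply: EFin_inj; rewrite -!lebesgue_measure_dyadic_set eqIJ.
have L0 := @dyadic_length_gt0 R J.
have sub (A B : dyadic) : dyadic_length A = dyadic_length B :> R ->
    dyadic_set A = dyadic_set B :> set R -> B.2 <= A.2.
  move=> eqAB eqS; have LA := @dyadic_length_gt0 R A.
  have : dyadic_set A (A.2%:~R * dyadic_length A : R).
    by rewrite /dyadic_set /= in_itv /= lexx ltr_pM2r// ltr_int ltrDl.
  rewrite eqS /dyadic_set /= in_itv /= -eqAB => /andP[+ _].
  by rewrite ler_pM2r// ler_int.
have eq2 : I.2 = J.2.
  by apply/eqP; rewrite eq_le !sub.
have eq1 : I.1 = J.1.
  by move: eqL; rewrite /dyadic_length => /(@ieexprIz R 2); apply;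
    rewrite ?ltr0n// (eqr_nat _ 2 1).
by case: I J eq1 eq2 {eqIJ eqL L0} => [a b] [c d] /= -> ->.
Qed.

Definition avg {R : realType} (f : R -> R) (I : dyadic) : R :=
  (dyadic_length I)^-1 * \int[lebesgue_measure]_(x in dyadic_set I) f x.

Definition weight {R : realType} (w : R -> R) : Prop :=
  locally_integrable setT w /\ {ae lebesgue_measure, forall x, 0 < w x}.

Definition alpha {R : realType} (v w : R -> R) (I : dyadic) : R :=
  `|(avg v (dyadic_left I) - avg v (dyadic_right I)) / avg v I|
  * `|(avg w (dyadic_left I) - avg w (dyadic_right I)) / avg w I|
  * dyadic_length I.

Definition T0_term {R : realType} (v w f : R -> R) (I : dyadic) (x : R) : R :=
  (dyadic_length I)^-1 * avg f I * alpha v w I * \1_(dyadic_set I) x.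

Definition T0_summable {R : realType} (v w f : R -> R) (x : R) : Prop :=
  summable [set: dyadic] (fun I => (T0_term v w f I x)%:E).

(* \esum is a supremum of finite sums, hence meaningful for nonnegative terms
   only; a signed family is summed through its positive and negative parts. *)
Definition T0 {R : realType} (v w f : R -> R) (x : R) : \bar R :=
  (\esum_(I in [set: dyadic]) (fun I => (T0_term v w f I x)%:E)^\+ I
   - \esum_(I in [set: dyadic]) (fun I => (T0_term v w f I x)%:E)^\- I)%E.

Definition L2norm {R : realType} (omega : R -> R) (f : R -> \bar R) : \bar R :=
  ((\int[lebesgue_measure]_x (`|f x| ^+ 2 * (omega x)%:E)) `^ 2^-1)%E.

Definition L2 {R : realType} (omega : R -> R) (f : R -> \bar R) : Prop :=
  measurable_fun [set: R] f /\ (L2norm omega f < +oo)%E.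

Definition T0_bounded {R : realType} (v w : R -> R) : Prop :=
  exists C : R, forall f : R -> R, L2 (fun x => (w x)^-1) (EFin \o f) ->
    [/\ {ae lebesgue_measure, forall x, T0_summable v w f x},
        L2 v (T0 v w f)
      & (L2norm v (T0 v w f)
         <= C%:E * L2norm (fun x => (w x)^-1%R) (EFin \o f))%E].

(* Used with g >= 0 almost everywhere, so that the terms are nonnegative. *)
Definition local_sum {R : realType} (v w g : R -> R) (J : dyadic) (x : R) :
    \bar R :=
  \esum_(I in [set I | dyadic_set I `<=` (dyadic_set J : set R)])
    (T0_term v w g I x)%:E.

(* Main.v *)
Require Import Defs.
From mathcomp Require Import all_boot all_order all_algebra.
From mathcomp Require Import ring lra zify.
From mathcomp Require Import all_classical all_reals all_analysis measurable_realfun.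
Import Order.TTheory GRing.Theory Num.Theory.
Import numFieldNormedType.Exports.
Local Open Scope classical_set_scope.
Local Open Scope ring_scope.

(** Changing [v] and [w] on a null set alters neither side, so both weights
    may be taken positive everywhere. With [lam I = alpha_I / |I|^2] the
    operator is [T0 f = sum_I lam I * (int_I f) * chi_I], and it is governed
    by the symmetric form [sum_I lam I * (int_I f) * (int_I g)].

    Necessity. The first testing condition is the bound for [f = w chi_J]
    ([sq_bounded_testing]). The second one is that bound for the adjoint: if
    [S] is a finite partial sum of the second local sum, the hypothesis is
    applied to [h = S w], the symmetry of the form turns the integral of
    [S^2 w] into that of [(T0 h) v] over [J], and the inequality between the
    arithmetic and the geometric mean absorbs the term in [h]
    ([sq_bounded_dual_testing]).

    Sufficiency. Finitely many dyadic intervals always lie in two finite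
    trees, one whose root runs from 0 to [2^N] and one whose root runs from
    [- 2^N] to 0, so by monotone convergence it is enough to bound [T0] on a
    finite tree with root [J], uniformly in the tree
    ([sq_bounded_of_testing]). There it suffices to show
      [sum_I lam I * F I * G I <= K * (P J + Q J)],
    where [F], [G], [P], [Q], [mu], [nu] are the integrals over [I] of
    nonnegative [f], [g], and of [f^2 / w], [g^2 / v], [w], [v]: inserting
    for [g] a small multiple of [(T0 f) v] makes the left side a multiple of
    the integral of [(T0 f)^2 v], and the term [Q J] is absorbed
    ([tree_sq_le]).

    For this inequality the intervals are split according to whether [G^2 /
    nu <= F^2 / mu] or not; the two parts are exchanged by the symmetry of
    the hypotheses ([tree_bilinear_le]). On the first part one descends the
    tree and stops as soon as the average [F / mu] exceeds twice the value
    [a] it had at the previous stop. Between two stops [F <= 2 a mu], so the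
    sum is at most [2 a] times the integral of [g] against the local sum of
    the testing condition, hence at most [a^2] times its energy plus a part
    of [Q]. At a stop, the choice of the part bounds [G^2 / nu] by [F^2 /
    mu]. What remains is the sum of [F^2 / mu] over all the stops, which is
    controlled by [P] because the averages at least double. This last fact
    is recorded by the potential [3 P - 4 a F + 4/3 a^2 mu]: it is additive
    over the two halves of an interval for fixed [a], it is nonnegative, and
    it drops by at least [F^2 / mu] at every stop. The whole argument thus
    becomes one induction on the depth of the tree ([tree_embedding_on]). *)

(** * The stopping-time argument on a finite tree *)

Fixpoint tree (n : nat) (I : dyadic) : seq dyadic :=
  if n is n'.+1
  then I :: tree n' (dyadic_left I) ++ tree n' (dyadic_right I) else [::].

Definition halving {R : realType} (X : dyadic -> R) : Prop :=
  forall I, X I = X (dyadic_left I) + X (dyadic_right I).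

(** Only the additive quantities attached to the intervals matter here.
    [Energy n I s] stands for the integral of [(s + S)^2] against the second
    weight, with [S] the local sum over the tree of depth [n] below [I] and [s]
    the contribution of the intervals above [I] since the last stop. *)
Lemma tree_embedding_on {R : realType} (mu nu F G P Q lam : dyadic -> R)
    (Energy : nat -> dyadic -> R -> R) (C : R) (A : pred dyadic) :
  halving mu -> halving F -> halving G -> halving P -> halving Q ->
  (forall I, 0 < mu I) -> (forall I, 0 < nu I) ->
  (forall I, 0 <= F I) -> (forall I, 0 <= G I) -> (forall I, 0 <= lam I) ->
  (forall I, F I ^+ 2 <= P I * mu I) -> (forall I, G I ^+ 2 <= Q I * nu I) ->
  (forall n I s, 0 <= s -> s ^+ 2 * nu I <= Energy n I s) ->
  (forall n I s, 0 <= s ->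
     Energy n (dyadic_left I) (s + lam I * mu I)
     + Energy n (dyadic_right I) (s + lam I * mu I) <= Energy n.+1 I s) ->
  (forall n I, Energy n I 0 <= C * mu I) ->
  {in A, forall I, G I ^+ 2 * mu I <= F I ^+ 2 * nu I} ->
  forall n J, \sum_(I <- tree n J | A I) lam I * F I * G I
    <= Q J + 3%:R * (C + 1) * P J.
Proof.
move=> hmu hF hG hP hQ mu0 nu0 F0 G0 lam0 FP GQ E0 ES EC hA.
have C0 : 0 <= C.
  have I0 : dyadic := (0, 0).
  have := le_trans (E0 0%N I0 0 (lexx _)) (EC 0%N I0).
  by rewrite expr0n mul0r pmulr_lge0.
(* The cost of a stop in units of [F^2 / mu]: [C] for the energy of the tree
   below, 1 for the mass that [g] has there. *)
pose D := C + 1; have D0 : 0 < D by rewrite /D; lra.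
pose S n J := \sum_(I <- tree n J | A I) lam I * F I * G I.
(* The discriminant in [a] is [16 (F^2 - P mu) <= 0], which gives
   nonnegativity; the coefficients also leave room for the drop at a stop. *)
pose Psi I a := 3%:R * P I - 4%:R * a * F I + 4%:R / 3%:R * a ^+ 2 * mu I.
have PsiD I a : Psi I a = Psi (dyadic_left I) a + Psi (dyadic_right I) a.
  by rewrite /Psi (hP I) (hF I) (hmu I); ring.
have Psi0 I a : 0 <= Psi I a.
  rewrite -(pmulr_rge0 _ (mu0 I)).
  have -> : mu I * Psi I a = 3%:R * (P I * mu I - F I ^+ 2)
     + 3%:R * (F I - 2%:R / 3%:R * a * mu I) ^+ 2 by rewrite /Psi; field.
  by have := FP I; have := sqr_ge0 (F I - 2%:R / 3%:R * a * mu I); lra.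
(* Cauchy-Schwarz in the form of the arithmetic-geometric mean inequality, for
   a constant function [s] on [I]. *)
have leaf I a s : 2%:R * a * s * G I <= a ^+ 2 * (s ^+ 2 * nu I) + Q I.
  rewrite -(ler_pM2r (nu0 I)).
  have := GQ I; have := sqr_ge0 (a * s * nu I - G I).
  by rewrite sqrrB; lra.
have SS n J : S n.+1 J = (if A J then lam J * F J * G J else 0)
    + (S n (dyadic_left J) + S n (dyadic_right J)).
  by rewrite /S /= big_cons big_cat /=; case: (A J); rewrite ?add0r.
suff main n : forall I a s, 0 <= a -> 0 <= s ->
    S n I + 2%:R * a * s * G I <= a ^+ 2 * Energy n I s + Q I + D * Psi I a.
  move=> n J; have := main n J 0 0 (lexx _) (lexx _).
  by rewrite /Psi /S /D !(mulr0, mul0r, expr0n) /=; lra.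
elim: n => [|n IH] I a s a0 s0.
  rewrite /S /= big_nil add0r.
  have := leaf I a s; have := E0 0%N I s s0.
  have /(ler_wpM2l (sqr_ge0 a)) := E0 0%N I s s0.
  by have := mulr_ge0 (ltW D0) (Psi0 I a); lra.
(* One step down the tree when [I] is not a stop for the value [b]. *)
have go b t : 0 <= b -> 0 <= t -> (A I -> F I <= 2%:R * b * mu I) ->
    S n.+1 I + 2%:R * b * t * G I
    <= b ^+ 2 * Energy n.+1 I t + Q I + D * Psi I b.
  move=> b0 t0 hb.
  set c := lam I * mu I.
  have c0 : 0 <= c by rewrite mulr_ge0// ltW.
  have tc0 : 0 <= t + c by rewrite addr_ge0.
  have L := IH (dyadic_left I) b (t + c) b0 tc0.
  have Rr := IH (dyadic_right I) b (t + c) b0 tc0.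
  have T := ler_wpM2l (sqr_ge0 b) (ES n I t t0).
  rewrite SS (hG I) (hQ I) PsiD.
  have : (if A I then lam I * F I * G I else 0) <= 2%:R * b * c * G I.
    case: ifP => [AI|_]; last first.
      by rewrite (mulr_ge0 _ (G0 I))// (mulr_ge0 _ c0)// mulr_ge0.
    rewrite ler_wpM2r// [leRHS](_ : _ = lam I * (2%:R * b * mu I)).
      by rewrite ler_wpM2l// hb.
    by rewrite /c; ring.
  move: T; rewrite -/c (hG I) mulrDr; lra.
(* [I] is a stop when it belongs to [A] and its average exceeds [2 a]. *)
have [/andP[AI lt]|] := boolP (A I && (2%:R * a * mu I < F I)); last first.
  move=> h; apply: go => // AI; rewrite leNgt; apply: contra h => h.
  by rewrite AI.
pose t := F I / mu I.
have Ft : F I = t * mu I by rewrite /t divfK// gt_eqF.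
have at2 : 2%:R * a < t by rewrite /t ltr_pdivlMr.
have t0 : 0 <= t by lra.
(* At a stop the accumulated sum [s] is paid off on [I] at once, and the tree
   below is treated afresh with the new value [t]. *)
have := go t 0 t0 (lexx _).
rewrite !(mulr0, mul0r) addr0 => /(_ _) goI.
have {goI} : S n.+1 I <= t ^+ 2 * Energy n.+1 I 0 + Q I + D * Psi I t.
  by apply: goI => _; rewrite Ft (ler_wpM2r (ltW (mu0 I)))//; lra.
have : t ^+ 2 * Energy n.+1 I 0 <= t ^+ 2 * (C * mu I).
  by rewrite ler_wpM2l ?sqr_ge0.
have : a ^+ 2 * (s ^+ 2 * nu I) <= a ^+ 2 * Energy n.+1 I s.
  by rewrite ler_wpM2l ?sqr_ge0// E0.
have : 2%:R * a * s * G I <= a ^+ 2 * (s ^+ 2 * nu I) + t ^+ 2 * mu I.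
  rewrite -(ler_pM2r (nu0 I)).
  have : G I ^+ 2 <= t ^+ 2 * mu I * nu I.
    by rewrite -(ler_pM2r (mu0 I)); have := hA I AI; rewrite Ft; lra.
  by have := sqr_ge0 (a * s * nu I - G I); rewrite sqrrB; lra.
(* The drop of the potential, available because [t >= 2 a]. *)
have : D * (Psi I t + t ^+ 2 * mu I) <= D * Psi I a.
  rewrite (ler_wpM2l (ltW D0))// -subr_ge0 /Psi Ft.
  have -> : 3%:R * P I - 4%:R * a * (t * mu I) + 4%:R / 3%:R * a ^+ 2 * mu I
    - (3%:R * P I - 4%:R * t * (t * mu I) + 4%:R / 3%:R * t ^+ 2 * mu I
       + t ^+ 2 * mu I)
    = mu I * ((t - 2%:R * a) * (5%:R * t - 2%:R * a) / 3%:R) by field.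
  apply: (mulr_ge0 (ltW (mu0 I))); apply: divr_ge0 => //.
  by apply: mulr_ge0; lra.
by have := sqr_ge0 t; rewrite /D; lra.
Qed.

(** * Dyadic intervals and trees *)

Section Combinatorics.
Context {R : realType}.
Local Notation dset := (@dyadic_set R).

Lemma dyadic_set_left_sub I : dset (dyadic_left I) `<=` dset I.
Proof. by rewrite (dyadic_set_halves I); left. Qed.

Lemma dyadic_set_right_sub I : dset (dyadic_right I) `<=` dset I.
Proof. by rewrite (dyadic_set_halves I); right. Qed.

Lemma dyadic_set_halves_disj I :
  [disjoint dset (dyadic_left I) & dset (dyadic_right I)].
Proof.
apply/disj_setPS => x [] /=; case: I => n k.
rewrite /dyadic_left /dyadic_right /dyadic_set /= !in_itv /=.
by move=> /andP[_ lt] /andP[le _]; move: (lt_le_trans lt le); rewrite ltxx.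
Qed.

Lemma dyadic_set_min I : dset I (I.2%:~R * dyadic_length I).
Proof.
rewrite /dyadic_set /= in_itv /= lexx ltr_pM2r ?dyadic_length_gt0//.
by rewrite ltr_int ltrDl.
Qed.

Lemma tree_sub n J I : I \in tree n J -> dset I `<=` dset J.
Proof.
elim: n J => [//|n IH] J; rewrite /= in_cons mem_cat.
case/or3P => [/eqP -> //| /IH h | /IH h].
- exact: subset_trans h (@dyadic_set_left_sub J).
- exact: subset_trans h (@dyadic_set_right_sub J).
Qed.

Lemma tree_gen n J I : I \in tree n J -> I.1 <= J.1.
Proof.
elim: n J => [//|n IH] J; rewrite /= in_cons mem_cat.
by case/or3P => [/eqP -> //| /IH /= h | /IH /= h]; lia.
Qed.

Lemma tree_uniq n J : uniq (tree n J).
Proof.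
elim: n J => [//|n IH] J /=; rewrite mem_cat cat_uniq !IH /= andbT.
apply/andP; split.
  by apply/norP; split; apply/negP => /tree_gen /=; lia.
apply/hasPn => I /tree_sub sr; apply/negP => /tree_sub sl.
have /disj_setPS/(_ (I.2%:~R * dyadic_length I))[] := dyadic_set_halves_disj J.
by split; [apply: sl|apply: sr]; exact: dyadic_set_min.
Qed.

(** The [2^d] intervals of generation [d] below [J] are indexed by the
    remainder [r]. *)
Lemma mem_tree n (J : dyadic) (d r : nat) : (d < n)%N -> (r < 2 ^ d)%N ->
  (J.1 - d%:Z, J.2 * (2 ^ d)%N%:Z + r%:Z) \in tree n J.
Proof.
elim: n J d r => [//|n IH] J [|d] r /= dn rd; rewrite in_cons mem_cat.
  have -> : r = 0%N by move: rd; rewrite expn0; lia.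
  by rewrite expn0 subr0 mulr1 addr0 -surjective_pairing eqxx.
have [rl|rl] := ltnP r (2 ^ d)%N.
  have /= := IH (dyadic_left J) d r dn rl.
  rewrite (_ : (_, _) = (J.1 - d.+1%:Z, J.2 * (2 ^ d.+1)%N%:Z + r%:Z)).
    by move=> ->; rewrite orbT.
  by congr pair; rewrite ?expnS; lia.
have rl' : (r - 2 ^ d < 2 ^ d)%N by move: rd; rewrite expnS; lia.
have /= := IH (dyadic_right J) d _ dn rl'.
rewrite (_ : (_, _) = (J.1 - d.+1%:Z, J.2 * (2 ^ d.+1)%N%:Z + r%:Z)).
  by move=> ->; rewrite !orbT.
by congr pair; rewrite ?expnS; lia.
Qed.

(** No single tree contains all the dyadic intervals, since none of them
    meets both half-lines; one exhausting tree is needed on each side of 0. *)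
Lemma mem_tree_quadrants (I : dyadic) : exists N : nat, forall n, (N <= n)%N ->
  (I \in tree (n + n) (n%:Z, 0)) || (I \in tree (n + n) (n%:Z, -1)).
Proof.
exists (`|I.1| + `|I.2| + 1)%N => n Nn.
pose d := `|n%:Z - I.1|%N.
have nd : n%:Z = I.1 + d by rewrite /d; lia.
have kd : (`|I.2| < 2 ^ d)%N.
  by apply: (@leq_ltn_trans d); [lia|exact: ltn_expl].
have dn : (d < n + n)%N by lia.
have [k0|k0] := leP 0 I.2.
  apply/orP; left.
  have := @mem_tree (n + n) (n%:Z, 0) d `|I.2|%N dn kd.
  by rewrite (_ : (_, _) = I)// [RHS]surjective_pairing; congr pair => /=; lia.
apply/orP; right.
have := @mem_tree (n + n) (n%:Z, -1) d (2 ^ d - `|I.2|)%N dn.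
rewrite (_ : (_, _) = I); first by apply; lia.
by rewrite [RHS]surjective_pairing; congr pair => /=; lia.
Qed.

End Combinatorics.

(** * Integrals of dyadic step functions *)

Section Integrals.
Context {R : realType}.
Local Notation mu := (@lebesgue_measure R).
Local Notation dset := (@dyadic_set R).

Definition dintegrable (J : dyadic) (f : R -> R) : Prop :=
  mu.-integrable (dset J) (EFin \o f).

Definition dint (f : R -> R) (J : dyadic) : R := \int[mu]_(x in dset J) f x.

Definition step (c : dyadic -> R) (X : seq dyadic) (x : R) : R :=
  \sum_(I <- X) c I * \1_(dset I) x.

Lemma measurable_dset J : measurable (dset J).
Proof. exact: measurable_itv. Qed.

Lemma dintE (f : R -> R) J : dintegrable J f ->
  (dint f J)%:E = (\int[mu]_(x in dset J) (f x)%:E)%E.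
Proof.
by move=> If; rewrite fineK// integrable_fin_num//; exact: measurable_dset.
Qed.

Lemma avgE (f : R -> R) J : avg f J = (dyadic_length J)^-1 * dint f J.
Proof. by []. Qed.

Lemma dintegrableZ k (f : R -> R) J : dintegrable J f ->
  dintegrable J (fun x => k * f x).
Proof.
rewrite /dintegrable => If.
under [X in _.-integrable _ X]eq_fun do rewrite EFinM.
by apply: integrableZl => //; exact: measurable_dset.
Qed.

Lemma dintegrable_dom (f g : R -> R) J (M : R) : measurable_fun setT f ->
  dintegrable J g -> (forall x, dset J x -> `|f x| <= M * g x) ->
  dintegrable J f.
Proof.
move=> mf Ig fg.
have IMg : mu.-integrable (dset J) (fun x => (M * g x)%:E).
  exact: dintegrableZ.
apply: le_integrable IMg; first exact: measurable_dset.
- by apply/measurable_EFinP; apply: measurable_funS mf.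
- by move=> x /fg fx; rewrite lee_fin (le_trans fx)// ler_norm.
Qed.

Lemma dint_halving (f : R -> R) : (forall J, dintegrable J f) ->
  halving (dint f).
Proof.
move=> If J; rewrite /dint (dyadic_set_halves J) Rintegral_setU//.
- exact: measurable_dset.
- exact: measurable_dset.
- by rewrite -dyadic_set_halves; exact: If.
- exact: dyadic_set_halves_disj.
Qed.

Lemma dint_ge0 (f : R -> R) J : (forall x, 0 <= f x) -> 0 <= dint f J.
Proof. by move=> f0; apply: Rintegral_ge0. Qed.

Lemma le_dint (f g : R -> R) J : dintegrable J f -> dintegrable J g ->
  (forall x, dset J x -> f x <= g x) -> dint f J <= dint g J.
Proof. by move=> *; apply: le_Rintegral => //; exact: measurable_dset. Qed.

Lemma dintZ k (f : R -> R) J : dintegrable J f ->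
  dint (fun x => k * f x) J = k * dint f J.
Proof. by move=> If; rewrite /dint RintegralZl//; exact: measurable_dset. Qed.

Lemma dintD (f g : R -> R) J : dintegrable J f -> dintegrable J g ->
  dint (fun x => f x + g x) J = dint f J + dint g J.
Proof. by move=> *; rewrite /dint RintegralD//; exact: measurable_dset. Qed.

Lemma dint_gt0 (f : R -> R) J : measurable_fun setT f -> dintegrable J f ->
  (forall x, 0 < f x) -> 0 < dint f J.
Proof.
move=> mf If f0; rewrite lt_neqAle dint_ge0 ?andbT; last by move=> x; exact: ltW.
apply/eqP => int0.
have : (\int[mu]_(x in dset J) `|(f x)%:E| = 0)%E.
  under eq_integral do rewrite gee0_abs ?lee_fin ?ltW//.
  by rewrite -dintE// -int0.
have mfJ : measurable_fun (dset J) (EFin \o f).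
  by apply/measurable_EFinP; apply: measurable_funS mf.
case/(ae_eq_integral_abs mu (measurable_dset J) mfJ).
move=> N [mN N0 sub].
have : (mu (dset J) <= mu N)%E.
  apply: le_measure; rewrite ?inE//; first exact: measurable_dset.
  apply: subset_trans sub => x Jx /= /(_ Jx) [fx0].
  by have := f0 x; rewrite fx0 ltxx.
by rewrite N0 lebesgue_measure_dyadic_set lee_fin leNgt dyadic_length_gt0.
Qed.

Lemma measurable_step c X : measurable_fun setT (step c X).
Proof.
apply: measurable_sum => I; apply: measurable_funM => //.
by apply: measurable_indic; exact: measurable_dset.
Qed.

Lemma step_ge0 c X x : (forall I, 0 <= c I) -> 0 <= step c X x.
Proof. by move=> c0; apply: sumr_ge0 => I _; rewrite mulr_ge0// indicE. Qed.

Lemma step_le c X x : (forall I, 0 <= c I) -> step c X x <= \sum_(I <- X) c I.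
Proof.
move=> c0; apply: ler_sum => I _; rewrite indicE.
by case: (_ \in _); rewrite ?mulr1 ?mulr0.
Qed.

Lemma dintegrable_step c X (f : R -> R) J : (forall I, 0 <= c I) ->
  (forall x, 0 <= f x) -> measurable_fun setT f -> dintegrable J f ->
  dintegrable J (fun x => step c X x * f x).
Proof.
move=> c0 f0 mf If.
apply: (@dintegrable_dom _ f _ (\sum_(I <- X) c I)) => //.
  by apply: measurable_funM => //; exact: measurable_step.
move=> x _; rewrite ger0_norm ?mulr_ge0// ?step_ge0//.
by rewrite ler_wpM2r// step_le.
Qed.

Lemma dint_step c X (f : R -> R) J : (forall I, 0 <= c I) ->
  (forall x, 0 <= f x) -> measurable_fun setT f -> dintegrable J f ->
  {in X, forall I, dset I `<=` dset J} ->
  dint (fun x => step c X x * f x) J = \sum_(I <- X) c I * dint f I.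
Proof.
move=> c0 f0 mf If; elim: X => [|I X IH] XJ.
  rewrite big_nil /dint; under eq_Rintegral do rewrite /step big_nil mul0r.
  by rewrite Rintegral_cst ?mul0r//; exact: measurable_dset.
have IJ : dset I `<=` dset J by apply: XJ; rewrite mem_head.
rewrite big_cons -IH; last by move=> K KX; apply: XJ; rewrite in_cons KX orbT.
have -> : (fun x => step c (I :: X) x * f x) =
    (fun x => c I * (f x * \1_(dset I) x) + step c X x * f x).
  by apply/funext => x; rewrite /step big_cons; ring.
have II : dintegrable J (fun x => f x * \1_(dset I) x).
  apply: (@dintegrable_dom _ f _ 1) => //.
    apply: measurable_funM => //.
    by apply: measurable_indic; exact: measurable_dset.
  move=> x _; rewrite indicE; case: (_ \in _); rewrite ?mulr1 ?mulr0 ?normr0 mul1r//.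
  by rewrite ger0_norm.
rewrite dintD ?dintZ//; [|exact: dintegrableZ|exact: dintegrable_step].
congr (_ * _ + _).
by rewrite /dint -[in RHS](setIidr IJ) Rintegral_mkcondr patch_indic.
Qed.

(** The shift [s] keeps track of the intervals above [I], on which the step
    function is constant throughout [I]. *)
Definition energy (v : R -> R) (c : dyadic -> R) n I s : R :=
  dint (fun x => (s + step c (tree n I) x) ^+ 2 * v x) I.

Lemma dintegrable_energy (v : R -> R) (c : dyadic -> R) X J (s : R) :
  measurable_fun setT v ->
  (forall x, 0 <= v x) -> dintegrable J v -> (forall I, 0 <= c I) -> 0 <= s ->
  dintegrable J (fun x => (s + step c X x) ^+ 2 * v x).
Proof.
move=> mv v0 Iv c0 s0.
apply: (@dintegrable_dom _ v _ ((s + \sum_(I <- X) c I) ^+ 2)) => //.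
  apply: measurable_funM => //; apply: measurable_funX.
  by apply: measurable_funD => //; exact: measurable_step.
move=> x _; rewrite ger0_norm ?(mulr_ge0 (sqr_ge0 _))// ler_wpM2r//.
have S0 := step_ge0 c X x c0.
by rewrite ler_pXn2r ?nnegrE ?addr_ge0// ?lerD2l ?step_le// sumr_ge0.
Qed.

Lemma energy_ge (v : R -> R) (c : dyadic -> R) n I (s : R) :
  measurable_fun setT v -> (forall x, 0 <= v x) ->
  dintegrable I v -> (forall I, 0 <= c I) -> 0 <= s ->
  s ^+ 2 * dint v I <= energy v c n I s.
Proof.
move=> mv v0 Iv c0 s0; rewrite -dintZ//; apply: le_dint.
- exact: dintegrableZ.
- exact: dintegrable_energy.
- move=> x _; rewrite ler_wpM2r//.
  by rewrite ler_pXn2r ?nnegrE ?addr_ge0 ?step_ge0// lerDl step_ge0.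
Qed.

Lemma step_out c n J x : ~ dset J x -> step c (tree n J) x = 0.
Proof.
move=> nJx; rewrite /step big_seq big1// => I /(@tree_sub R) IJ.
by rewrite indicE memNset ?mulr0// => /IJ.
Qed.

Lemma step_treeS c n J x : step c (tree n.+1 J) x =
  c J * \1_(dset J) x + (step c (tree n (dyadic_left J)) x
                         + step c (tree n (dyadic_right J)) x).
Proof. by rewrite /step /= big_cons big_cat. Qed.

(** On each half of [I] the term of [I] itself is constant and the tree below
    the other half vanishes. *)
Lemma energy_split (v : R -> R) (c : dyadic -> R) n I (s : R) :
  measurable_fun setT v -> (forall x, 0 <= v x) ->
  dintegrable I v -> (forall I, 0 <= c I) -> 0 <= s ->
  energy v c n (dyadic_left I) (s + c I) + energy v c n (dyadic_right I) (s + c I)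
  = energy v c n.+1 I s.
Proof.
move=> mv v0 Iv c0 s0.
have := dintegrable_energy v c (tree n.+1 I) I s mv v0 Iv c0 s0.
rewrite /dintegrable [in RHS]/energy /dint (dyadic_set_halves I) => It.
have /disj_setPS LR := @dyadic_set_halves_disj R I.
rewrite Rintegral_setU//; last exact: dyadic_set_halves_disj.
- have h x : dset I x -> step c (tree n.+1 I) x
      = c I + (step c (tree n (dyadic_left I)) x
               + step c (tree n (dyadic_right I)) x).
    by move=> Ix; rewrite step_treeS indicE mem_set// mulr1.
  congr (_ + _); apply: eq_Rintegral => x; rewrite inE => xI.
    rewrite (h _ (dyadic_set_left_sub _ _ xI))
            [step c (tree n (dyadic_right I)) x]step_out.
      by rewrite addr0 addrA.
    by move=> xr; have [] := LR x.
  rewrite (h _ (dyadic_set_right_sub _ _ xI))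
          [step c (tree n (dyadic_left I)) x]step_out.
    by rewrite add0r addrA.
  by move=> xr; have [] := LR x.
- exact: measurable_dset.
- exact: measurable_dset.
Qed.

End Integrals.

(** * Two-weight bounds on a finite tree *)

Section TwoWeight.
Context {R : realType}.
Local Notation mu := (@lebesgue_measure R).
Local Notation dset := (@dyadic_set R).

Definition pos_weight (w : R -> R) : Prop :=
  [/\ measurable_fun setT w, (forall x, 0 < w x)
    & forall J, dintegrable J w].

(** Since the trees below [J] exhaust the dyadic subintervals of [J], this is
    the testing condition on [J] for the coefficients [lam]. *)
Definition testing (lam : dyadic -> R) (v w : R -> R) (C : R) : Prop :=
  forall n J, energy v (fun I => lam I * dint w I) n J 0 <= C * dint w J.

Lemma dintegrable_step_sq (c : dyadic -> R) (v : R -> R) X J : pos_weight v ->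
  (forall I, 0 <= c I) -> dintegrable J (fun x => step c X x ^+ 2 * v x).
Proof.
move=> [mv v0 Iv] c0.
have v0' x : 0 <= v x by exact: ltW.
have := @dintegrable_energy _ v c X J 0 mv v0' (Iv J) c0 (lexx _).
by rewrite /dintegrable; under eq_fun do rewrite add0r.
Qed.

(** Writing [1/w] as [w * (w^2)^(-1)] reduces the claim to the measurability of
    real powers. *)
Lemma measurable_inv (w : R -> R) : measurable_fun setT w ->
  measurable_fun setT (fun x => (w x)^-1).
Proof.
move=> mw.
have -> : (fun x => (w x)^-1) = (fun x => w x * (w x ^+ 2) `^ (-1)).
  apply/funext => x; rewrite powR_inv1 ?sqr_ge0//.
  have [->|wx] := eqVneq (w x) 0; first by rewrite invr0 mul0r.
  by field.
apply: measurable_funM => //.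
apply: (@measurableT_comp _ _ _ _ _ _ (fun t : R => t `^ (-1))) => //.
exact: measurable_funX.
Qed.

Lemma measurable_sq_div (w f : R -> R) : measurable_fun setT w ->
  (forall x, 0 < w x) -> measurable_fun setT f ->
  measurable_fun setT (fun x => f x ^+ 2 * (w x)^-1).
Proof.
move=> mw w0 mf; apply: measurable_funM; first exact: measurable_funX.
exact: measurable_inv.
Qed.

Lemma young_weighted (w : R) (f t : R) : 0 < w ->
  2%:R * t * f <= f ^+ 2 * w^-1 + t ^+ 2 * w.
Proof.
move=> w0; rewrite -subr_ge0.
have -> : f ^+ 2 * w^-1 + t ^+ 2 * w - 2%:R * t * f = (f - t * w) ^+ 2 / w.
  by field; rewrite gt_eqF.
by rewrite divr_ge0 ?sqr_ge0// ltW.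
Qed.

Lemma dintegrable_of_sq (w f : R -> R) J : pos_weight w ->
  measurable_fun setT f -> (forall x, 0 <= f x) ->
  dintegrable J (fun x => f x ^+ 2 * (w x)^-1) -> dintegrable J f.
Proof.
move=> [mw w0 Iw] mf f0 If.
have Is : dintegrable J (fun x => f x ^+ 2 * (w x)^-1 + w x).
  rewrite /dintegrable; under [X in _.-integrable _ X]eq_fun do rewrite EFinD.
  by apply: integrableD => //; [exact: measurable_dset|exact: Iw].
apply: (@dintegrable_dom _ _ _ _ 1 mf Is) => x _.
rewrite ger0_norm// mul1r; have := young_weighted (w x) (f x) 1 (w0 x).
by have := f0 x; lra.
Qed.

(** Integrating [young_weighted] with [t] the weighted average of [f], which is
    the optimal constant. *)
Lemma dint_cauchy_schwarz (w f : R -> R) J : pos_weight w ->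
  measurable_fun setT f -> (forall x, 0 <= f x) ->
  dintegrable J (fun x => f x ^+ 2 * (w x)^-1) ->
  dint f J ^+ 2 <= dint (fun x => f x ^+ 2 * (w x)^-1) J * dint w J.
Proof.
move=> pw mf f0 Ifw; have [mw w0 Iw] := pw.
have If := dintegrable_of_sq w f J pw mf f0 Ifw.
have W0 : 0 < dint w J by exact: dint_gt0.
pose t := dint f J / dint w J.
have : dint (fun x => (2%:R * t) * f x) J
    <= dint (fun x => f x ^+ 2 * (w x)^-1 + t ^+ 2 * w x) J.
  apply: le_dint; first exact: dintegrableZ.
    rewrite /dintegrable; under [X in _.-integrable _ X]eq_fun do rewrite EFinD.
    by apply: integrableD => //; [exact: measurable_dset|exact: dintegrableZ].
  by move=> x _; exact: young_weighted.
rewrite dintD//; last exact: dintegrableZ.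
rewrite !dintZ// (_ : dint f J = t * dint w J); last by rewrite /t divfK ?gt_eqF.
move=> le1; have := ler_wpM2r (ltW W0) le1; lra.
Qed.

(** [tree_embedding_on] bounds the part of the sum where
    [G^2 * mu <= F^2 * nu]; the complementary part is the same situation with
    [w] and [f] exchanged with [v] and [g]. *)
Lemma tree_bilinear_le (lam : dyadic -> R) (v w f g : R -> R) (C : R) n J :
  pos_weight v -> pos_weight w -> (forall I, 0 <= lam I) ->
  testing lam v w C -> testing lam w v C ->
  measurable_fun setT f -> measurable_fun setT g ->
  (forall x, 0 <= f x) -> (forall x, 0 <= g x) ->
  (forall I, dintegrable I (fun x => f x ^+ 2 * (w x)^-1)) ->
  (forall I, dintegrable I (fun x => g x ^+ 2 * (v x)^-1)) ->
  \sum_(I <- tree n J) lam I * dint f I * dint g I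
    <= (3%:R * C + 4%:R) * (dint (fun x => f x ^+ 2 * (w x)^-1) J
                            + dint (fun x => g x ^+ 2 * (v x)^-1) J).
Proof.
move=> pv pw lam0 tvw twv mf mg f0 g0 Ifw Igv.
have [mv v0 Iv] := pv; have [mw w0 Iw] := pw.
have If I := dintegrable_of_sq w f I pw mf f0 (Ifw I).
have Ig I := dintegrable_of_sq v g I pv mg g0 (Igv I).
have P0 I : 0 <= dint w I by rewrite dint_ge0// => x; exact: ltW.
have Q0 I : 0 <= dint v I by rewrite dint_ge0// => x; exact: ltW.
pose A : pred dyadic := [pred I | dint g I ^+ 2 * dint w I
                                  <= dint f I ^+ 2 * dint v I].
have cw I : 0 <= lam I * dint w I by rewrite mulr_ge0.
have cv I : 0 <= lam I * dint v I by rewrite mulr_ge0.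
have v0' x : 0 <= v x by exact: ltW.
have w0' x : 0 <= w x by exact: ltW.
rewrite (bigID A) /=.
have EA := @tree_embedding_on _ (dint w) (dint v) (dint f) (dint g)
  (dint (fun x => f x ^+ 2 * (w x)^-1)) (dint (fun x => g x ^+ 2 * (v x)^-1))
  lam (energy v (fun I => lam I * dint w I)) C A.
have EB := @tree_embedding_on _ (dint v) (dint w) (dint g) (dint f)
  (dint (fun x => g x ^+ 2 * (v x)^-1)) (dint (fun x => f x ^+ 2 * (w x)^-1))
  lam (energy w (fun I => lam I * dint v I)) C (predC A).
have {}EA : \sum_(I <- tree n J | A I) lam I * dint f I * dint g I
   <= dint (fun x => g x ^+ 2 * (v x)^-1) J
    + 3%:R * (C + 1) * dint (fun x => f x ^+ 2 * (w x)^-1) J.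
  apply: EA => //; try exact: dint_halving.
  - by move=> I; exact: dint_gt0.
  - by move=> I; exact: dint_gt0.
  - by move=> I; exact: dint_ge0.
  - by move=> I; exact: dint_ge0.
  - by move=> I; exact: dint_cauchy_schwarz.
  - by move=> I; exact: dint_cauchy_schwarz.
  - by move=> m I s s0; exact: energy_ge.
  - by move=> m I s s0; rewrite energy_split.
have {}EB : \sum_(I <- tree n J | ~~ A I) lam I * dint g I * dint f I
   <= dint (fun x => f x ^+ 2 * (w x)^-1) J
    + 3%:R * (C + 1) * dint (fun x => g x ^+ 2 * (v x)^-1) J.
  apply: EB => //; try exact: dint_halving.
  - by move=> I; exact: dint_gt0.
  - by move=> I; exact: dint_gt0.
  - by move=> I; exact: dint_ge0.
  - by move=> I; exact: dint_ge0.
  - by move=> I; exact: dint_cauchy_schwarz.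
  - by move=> I; exact: dint_cauchy_schwarz.
  - by move=> m I s s0; exact: energy_ge.
  - by move=> m I s s0; rewrite energy_split.
  - by move=> I; rewrite !inE -ltNge => /ltW.
under [in X in _ + X <= _]eq_bigr do rewrite mulrAC.
by lra.
Qed.

(** Duality: [tree_bilinear_le] is used with [g] a small multiple of the local
    sum times [v], small enough for the resulting energy term on the right to
    be absorbed by the left side. *)
Lemma tree_sq_le (lam : dyadic -> R) (v w f : R -> R) (C : R) n J :
  pos_weight v -> pos_weight w -> (forall I, 0 <= lam I) ->
  testing lam v w C -> testing lam w v C ->
  measurable_fun setT f -> (forall x, 0 <= f x) ->
  (forall I, dintegrable I (fun x => f x ^+ 2 * (w x)^-1)) ->
  dint (fun x => step (fun I => lam I * dint f I) (tree n J) x ^+ 2 * v x) J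
    <= (2%:R * (3%:R * C + 4%:R)) ^+ 2 * dint (fun x => f x ^+ 2 * (w x)^-1) J.
Proof.
move=> pv pw lam0 tvw twv mf f0 Ifw.
have [mv v0 Iv] := pv; have [mw w0 Iw] := pw.
have v0' x : 0 <= v x by exact: ltW.
have C0 : 0 <= C.
  have W0 : 0 < dint w J by exact: dint_gt0.
  rewrite -(pmulr_lge0 _ W0); apply: le_trans (tvw 0%N J).
  by apply: dint_ge0 => x; rewrite mulr_ge0// sqr_ge0.
pose K := 3%:R * C + 4%:R; have K0 : 0 < K by rewrite /K; lra.
pose c I := lam I * dint f I.
have c0 I : 0 <= c I by rewrite mulr_ge0// dint_ge0.
pose S := step c (tree n J).
have S0 x : 0 <= S x by exact: step_ge0.
have mS : measurable_fun setT S by exact: measurable_step.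
(* With this [e] the term [K e^2 N] is half of the left side [e N]. *)
pose e := (2%:R * K)^-1; have e0 : 0 < e by rewrite invr_gt0 mulr_gt0.
pose g x := e * (S x * v x).
have mSv : measurable_fun setT (fun x => S x * v x) by exact: measurable_funM.
have mg : measurable_fun setT g by exact: measurable_funM.
have g0 x : 0 <= g x by rewrite /g !mulr_ge0// ltW.
have gE : (fun x => g x ^+ 2 * (v x)^-1) = (fun x => e ^+ 2 * (S x ^+ 2 * v x)).
  by apply/funext => x; rewrite /g; field; rewrite gt_eqF.
have ISv I : dintegrable I (fun x => S x ^+ 2 * v x).
  exact: dintegrable_step_sq.
have Igv I : dintegrable I (fun x => g x ^+ 2 * (v x)^-1).
  by rewrite gE; exact: dintegrableZ.
have := tree_bilinear_le lam v w f g C n J pv pw lam0 tvw twv mf mg f0 g0 Ifw Igv.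
have ISv1 : dintegrable J (fun x => S x * v x) by exact: dintegrable_step.
have Ig : dintegrable J g by exact: dintegrableZ.
rewrite -[X in X <= _](@dint_step _ c (tree n J) g J)//; last first.
  by move=> I; exact: tree_sub.
rewrite gE (dintZ (e ^+ 2))// -/S -/K.
have -> : (fun x => S x * g x) = (fun x => e * (S x ^+ 2 * v x)).
  by apply/funext => x; rewrite /g; ring.
rewrite dintZ//.
set N := dint _ J; set P := dint _ J => le1.
have Ke : 2%:R * K * e = 1 by rewrite /e divff// gt_eqF// mulr_gt0.
have := ler_wpM2l (ltW (mulr_gt0 (ltr0n _ 4) K0)) le1.
rewrite -/N.
have -> : 4%:R * K * (e * N) = 2%:R * (2%:R * K * e) * N by ring.
have -> : 4%:R * K * (K * (P + e ^+ 2 * N))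
  = (2%:R * K) ^+ 2 * P + (2%:R * K * e) ^+ 2 * N by ring.
by rewrite Ke; lra.
Qed.

End TwoWeight.

(** * Countable sums as monotone limits *)

Section CountableSums.
Context {R : realType} {T : countType}.

Lemma le_sum_subseq (s t : seq T) (a : T -> R) : (forall i, 0 <= a i) ->
  uniq s -> {subset s <= t} -> \sum_(i <- s) a i <= \sum_(i <- t) a i.
Proof.
move=> a0; elim: s t => [|i s IH] t /=; first by rewrite big_nil sumr_ge0.
move=> /andP[iNs us] st; have it : i \in t by apply: st; rewrite mem_head.
rewrite big_cons (perm_big _ (perm_to_rem it)) big_cons lerD2l; apply: IH => //.
move=> j js; have : j \in t by apply: st; rewrite in_cons js orbT.
rewrite (perm_mem (perm_to_rem it)) in_cons => /predU1P[ji|//].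
by rewrite ji in js; rewrite js in iNs.
Qed.

(** An increasing exhaustion of a countable set by finite sets, so that sums
    over it become limits to which monotone convergence applies. *)
Definition enum_upto (D : set T) (n : nat) : seq T :=
  [seq i <- pmap pickle_inv (iota 0 n) | i \in D].

Lemma mem_enum_upto (D : set T) n i :
  (i \in enum_upto D n) = (i \in D) && (pickle i < n)%N.
Proof.
rewrite mem_filter; congr (_ && _); rewrite mem_pmap.
apply/mapP/idP => [[k kn ki]|lt].
  have := @pickle_invK T k; rewrite -ki /= => ik.
  by move: kn; rewrite mem_iota ik.
by exists (pickle i); rewrite ?mem_iota// pickleK_inv.
Qed.

Lemma enum_upto_uniq (D : set T) n : uniq (enum_upto D n).
Proof.
by rewrite filter_uniq// (pmap_uniq (@pickle_invK T))// iota_uniq.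
Qed.

Lemma le_sum_esum (D : set T) (a : T -> R) (s : seq T) :
  uniq s -> {in s, forall i, D i} ->
  ((\sum_(i <- s) a i)%:E <= \esum_(i in D) (a i)%:E)%E.
Proof.
move=> us sD; apply: esum_ge; exists [set` s].
  by split; [exact: finite_seq|move=> i /=; exact: sD].
by rewrite -fsbig_seq//= sumEFin.
Qed.

Lemma sum_enum_upto_homo (D : set T) (a : T -> R) : (forall i, 0 <= a i) ->
  {homo (fun n => \sum_(i <- enum_upto D n) a i) : n m / (n <= m)%N >-> n <= m}.
Proof.
move=> a0 n m nm; apply: le_sum_subseq => //; first exact: enum_upto_uniq.
by move=> i; rewrite !mem_enum_upto => /andP[-> /leq_trans]; exact.
Qed.

Lemma cvg_esum (D : set T) (a : T -> R) : (forall i, 0 <= a i) ->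
  (\sum_(i <- enum_upto D n) a i)%:E @[n --> \oo] --> \esum_(i in D) (a i)%:E.
Proof.
move=> a0; have -> : \esum_(i in D) (a i)%:E =
    ereal_sup (range (fun n => (\sum_(i <- enum_upto D n) a i)%:E)).
  apply/eqP; rewrite eq_le; apply/andP; split; last first.
    apply: ge_ereal_sup => _ [n _ <-]; apply: le_sum_esum.
      exact: enum_upto_uniq.
    by move=> i; rewrite mem_enum_upto => /andP[/set_mem].
  apply: ge_ereal_sup => _ [A [/finite_seqP[s As] AD] <-].
  pose n := (\max_(i <- s) pickle i).+1.
  apply: (@le_trans _ _ (\sum_(i <- enum_upto D n) a i)%:E); last first.
    by apply: ereal_sup_ubound; exists n.
  have -> : A = [set` undup s].
    by rewrite As; apply/seteqP; split => i /=; rewrite mem_undup.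
  rewrite -fsbig_seq ?undup_uniq//= sumEFin lee_fin.
  apply: le_sum_subseq => //; first exact: undup_uniq.
  move=> i; rewrite mem_undup mem_enum_upto => si.
  rewrite mem_set/=; last by apply: AD; rewrite As.
  by rewrite /n ltnS (big_rem i)//= leq_maxl.
apply: ereal_nondecreasing_cvgn => n m nm.
by rewrite lee_fin; exact: sum_enum_upto_homo.
Qed.

Lemma measurable_esum d (X : measurableType d) (D : set T) (F : T -> X -> R) :
  (forall i x, 0 <= F i x) -> (forall i, measurable_fun setT (F i)) ->
  measurable_fun setT (fun x => \esum_(i in D) (F i x)%:E).
Proof.
move=> F0 mF.
apply: (@emeasurable_fun_cvg _ _ _ _
  (fun n x => (\sum_(i <- enum_upto D n) F i x)%:E)).
- by move=> n; apply/measurable_EFinP; exact: measurable_sum.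
- by move=> x _; exact: cvg_esum.
Qed.

End CountableSums.

Section DyadicSums.
Context {R : realType}.
Local Notation mu := (@lebesgue_measure R).
Local Notation dset := (@dyadic_set R).

Definition step_series (D : set dyadic) (c : dyadic -> R) (x : R) : \bar R :=
  \esum_(I in D) (c I * \1_(dset I) x)%:E.

Lemma step_term_ge0 (c : dyadic -> R) I x : (forall I, 0 <= c I) ->
  0 <= c I * \1_(dset I) x.
Proof. by move=> c0; rewrite mulr_ge0// indicE. Qed.

Lemma measurable_step_series D (c : dyadic -> R) : (forall I, 0 <= c I) ->
  measurable_fun setT (step_series D c).
Proof.
move=> c0; apply: measurable_esum => [I x|I]; first exact: step_term_ge0.
apply: measurable_funM => //.
by apply: measurable_indic; exact: measurable_dset.
Qed.

Lemma step_series_ge0 D (c : dyadic -> R) x : (forall I, 0 <= c I) ->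
  (0 <= step_series D c x)%E.
Proof. by move=> c0; apply: esum_ge0 => I _; rewrite lee_fin step_term_ge0. Qed.

Lemma step_le_series (D : set dyadic) (c : dyadic -> R) X x :
  uniq X -> {in X, forall I, D I} -> ((step c X x)%:E <= step_series D c x)%E.
Proof. exact: le_sum_esum. Qed.

(** Monotone convergence: the square of the full series is the increasing limit
    of the squares of its partial sums. *)
Lemma integral_step_series_sq_le (D : set dyadic) (c : dyadic -> R)
    (v : R -> R) (E : set R) (B : \bar R) :
  (forall I, 0 <= c I) -> (forall x, 0 <= v x) -> measurable_fun setT v ->
  measurable E ->
  (forall X, uniq X -> {in X, forall I, D I} ->
    (\int[mu]_(x in E) (step c X x ^+ 2 * v x)%:E <= B)%E) ->
  (\int[mu]_(x in E) (step_series D c x ^+ 2 * (v x)%:E) <= B)%E.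
Proof.
move=> c0 v0 mv mE hB.
pose s n x := step c (enum_upto D n) x.
have s0 n x : 0 <= s n x by exact: step_ge0.
pose g n x := (s n x ^+ 2 * v x)%:E.
have cg x : g n x @[n --> \oo] --> (step_series D c x ^+ 2 * (v x)%:E)%E.
  have cs : (s n x)%:E @[n --> \oo] --> step_series D c x.
    by apply: cvg_esum => I; exact: step_term_ge0.
  rewrite /g; under eq_fun do rewrite EFinM expr2 EFinM.
  apply: cvgeZr => //; rewrite expe2; apply: cvgeM => //.
  by have := step_series_ge0 D c x c0; case: (step_series D c x).
have cv : (\int[mu]_(x in E) g n x)%E @[n --> \oo] -->
    (\int[mu]_(x in E) (step_series D c x ^+ 2 * (v x)%:E))%E.
  have <- : (\int[mu]_(x in E) limn (g ^~ x) =
      \int[mu]_(x in E) (step_series D c x ^+ 2 * (v x)%:E))%E.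
    by apply: eq_integral => x _; apply: cvg_lim.
  apply: cvg_monotone_convergence => //.
  - move=> n; apply/measurable_EFinP.
    apply: (@measurable_funS _ _ _ _ setT) => //.
    apply: measurable_funM => //; apply: measurable_funX.
    exact: measurable_step.
  - by move=> n x _; rewrite lee_fin mulr_ge0// sqr_ge0.
  - move=> x _ n m nm; rewrite lee_fin ler_wpM2r// ler_pXn2r ?nnegrE//.
    by apply: sum_enum_upto_homo nm => I; exact: step_term_ge0.
rewrite -(cvg_lim _ cv)//; apply: lime_le; first exact: cvgP cv.
apply: nearW => n; apply: hB; first exact: enum_upto_uniq.
by move=> I; rewrite mem_enum_upto => /andP[/set_mem].
Qed.

End DyadicSums.

(** * Sufficiency of the testing conditions *)

Section Boundedness.
Context {R : realType}.
Local Notation mu := (@lebesgue_measure R).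
Local Notation dset := (@dyadic_set R).

(** Boundedness from [L^2(1/w)] to [L^2(v)] of the positive operator with
    coefficients [lam], with squared norms and nonnegative arguments only. *)
Definition sq_bounded (lam : dyadic -> R) (v w : R -> R) (B : R) : Prop :=
  forall f : R -> R, measurable_fun setT f -> (forall x, 0 <= f x) ->
  (\int[mu]_x (f x ^+ 2 * (w x)^-1)%:E < +oo)%E ->
  (\int[mu]_x (step_series setT (fun I => (lam I * dint f I)%R) x ^+ 2 * (v x)%:E)
     <= B%:E * \int[mu]_x (f x ^+ 2 * (w x)^-1)%:E)%E.

Lemma integral_dset (g : R -> R) J : dintegrable J g ->
  (forall x, ~ dset J x -> g x = 0) -> (\int[mu]_x (g x)%:E = (dint g J)%:E)%E.
Proof.
move=> Ig g0; rewrite dintE// [RHS]integral_mkcond; apply: eq_integral => x _.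
by rewrite /patch; case: ifPn => // /negP xJ; rewrite g0// => /mem_set.
Qed.

Lemma dintegrable_of_lty (g : R -> R) J : measurable_fun setT g ->
  (forall x, 0 <= g x) -> (\int[mu]_x (g x)%:E < +oo)%E -> dintegrable J g.
Proof.
move=> mg g0 Ig; apply: (@integrableS _ _ _ _ setT) => //.
  exact: measurable_dset.
apply/integrableP; split; first exact/measurable_EFinP.
by under eq_integral do rewrite /= ger0_norm//.
Qed.

Lemma dint_le_integral (g : R -> R) J : measurable_fun setT g ->
  (forall x, 0 <= g x) -> (\int[mu]_x (g x)%:E < +oo)%E ->
  ((dint g J)%:E <= \int[mu]_x (g x)%:E)%E.
Proof.
move=> mg g0 Ig; rewrite dintE; last exact: dintegrable_of_lty.
apply: ge0_subset_integral => //; first exact: measurable_dset.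
  exact/measurable_EFinP.
by move=> x _; rewrite lee_fin.
Qed.

Lemma sub_quadrants (X : seq dyadic) : exists N : nat,
  {subset X <= tree (N + N) (N%:Z, 0) ++ tree (N + N) (N%:Z, -1)}.
Proof.
suff [N HN] : exists N : nat, forall n, (N <= n)%N ->
    {subset X <= tree (n + n) (n%:Z, 0) ++ tree (n + n) (n%:Z, -1)}.
  by exists N; exact: HN.
elim: X => [|I X [N HN]]; first by exists 0%N => n _ J.
have [M HM] := mem_tree_quadrants I.
exists (maxn N M) => n; rewrite geq_max => /andP[Nn Mn] J.
rewrite in_cons => /predU1P[->|]; last exact: HN.
by rewrite mem_cat; exact: HM.
Qed.

(** The two trees of [sub_quadrants] cost a factor 4: two from squaring a sum
    of two terms, two from adding up both trees. *)
Lemma sq_bounded_of_testing (lam : dyadic -> R) (v w : R -> R) (C : R) :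
  pos_weight v -> pos_weight w -> (forall I, 0 <= lam I) ->
  testing lam v w C -> testing lam w v C ->
  sq_bounded lam v w (4%:R * (2%:R * (3%:R * C + 4%:R)) ^+ 2).
Proof.
move=> pv pw lam0 tvw twv f mf f0 Pfin.
have [mv v0 Iv] := pv; have [mw w0 Iw] := pw.
have v0' x : 0 <= v x by exact: ltW.
pose h x := f x ^+ 2 * (w x)^-1.
have h0 x : 0 <= h x by rewrite mulr_ge0 ?sqr_ge0// invr_ge0 ltW.
have mh : measurable_fun setT h by exact: measurable_sq_div.
have Ih I : dintegrable I h by exact: dintegrable_of_lty.
pose c I := lam I * dint f I.
have c0 I : 0 <= c I by rewrite mulr_ge0// dint_ge0.
pose K2 := (2%:R * (3%:R * C + 4%:R)) ^+ 2.
pose S J n x := step c (tree n J) x ^+ 2 * v x.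
have mS J n : measurable_fun setT (S J n).
  apply: measurable_funM => //; apply: measurable_funX; exact: measurable_step.
have mS2 J n : measurable_fun setT (fun x => 2 * S J n x).
  by apply: measurable_funM => //; exact: mS.
have S0 J n x : 0 <= S J n x by rewrite mulr_ge0// sqr_ge0.
have SE J n : (\int[mu]_x (S J n x)%:E = (dint (S J n) J)%:E)%E.
  apply: integral_dset; last by move=> x xJ; rewrite /S step_out// expr0n mul0r.
  exact: dintegrable_step_sq.
have SP J n : (\int[mu]_x (S J n x)%:E <= K2%:E * \int[mu]_x (h x)%:E)%E.
  rewrite SE; apply: (@le_trans _ _ (K2 * dint h J)%:E).
    by rewrite lee_fin; exact: tree_sq_le.
  by rewrite EFinM lee_wpmul2l ?lee_fin ?sqr_ge0//; exact: dint_le_integral.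
have Z2 J n : (\int[mu]_x (2%:E * (S J n x)%:E)
    = 2%:E * \int[mu]_x (S J n x)%:E)%E.
  rewrite ge0_integralZl//; first by apply/measurable_EFinP; exact: mS.
  by move=> x _; rewrite lee_fin.
apply: integral_step_series_sq_le => // X uX _.
have [N XN] := sub_quadrants X.
pose J1 : dyadic := (N%:Z, 0); pose J2 : dyadic := (N%:Z, -1).
apply: (@le_trans _ _ (\int[mu]_x
   (2%:E * (S J1 (N + N)%N x)%:E + 2%:E * (S J2 (N + N)%N x)%:E))%E).
  apply: ge0_le_integral => //.
  - by move=> x _; rewrite lee_fin mulr_ge0// sqr_ge0.
  - apply/measurable_EFinP; apply: measurable_funM => //.
    by apply: measurable_funX; exact: measurable_step.
  - under eq_fun do rewrite -!EFinM -EFinD.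
    by apply/measurable_EFinP; apply: measurable_funD; exact: mS2.
  move=> x _; rewrite -!EFinM -EFinD lee_fin /S !mulrA -mulrDl ler_wpM2r//.
  have : step c X x <= step c (tree (N + N) J1) x + step c (tree (N + N) J2) x.
    rewrite /step -big_cat; apply: le_sum_subseq => // I.
    exact: step_term_ge0.
  have := step_ge0 c X x c0.
  set a := step c X x; set b := step _ _ _; set d := step _ _ _ => a0 abd.
  apply: (@le_trans _ _ ((b + d) ^+ 2)).
    by rewrite ler_pXn2r ?nnegrE//; exact: le_trans abd.
  by have := sqr_ge0 (b - d); lra.
rewrite ge0_integralD//; first last.
- by apply/measurable_EFinP; exact: mS2.
- by move=> x _; rewrite -EFinM lee_fin mulr_ge0.
- by apply/measurable_EFinP; exact: mS2.
- by move=> x _; rewrite -EFinM lee_fin mulr_ge0.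
rewrite !Z2.
have -> : (4 * K2)%:E = (2%:E * K2%:E + 2%:E * K2%:E)%E.
  by rewrite -!EFinM -EFinD; congr EFin; ring.
rewrite ge0_muleDl ?mule_ge0 ?lee_fin ?sqr_ge0//.
by apply: leeD; rewrite -muleA lee_wpmul2l.
Qed.

End Boundedness.

(** * Necessity of the testing conditions *)

Section Necessity.
Context {R : realType}.
Local Notation mu := (@lebesgue_measure R).
Local Notation dset := (@dyadic_set R).

Lemma integral_step_sq (c : dyadic -> R) (v : R -> R) X J : pos_weight v ->
  (forall I, 0 <= c I) ->
  (\int[mu]_(x in dset J) (step c X x ^+ 2 * v x)%:E
     = (dint (fun x => step c X x ^+ 2 * v x) J)%:E)%E.
Proof. by move=> pv c0; rewrite dintE//; exact: dintegrable_step_sq. Qed.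

Lemma integral_step_sq_le_series (D : set dyadic) (c : dyadic -> R)
    (v : R -> R) X J : pos_weight v -> (forall I, 0 <= c I) ->
  uniq X -> {in X, forall I, D I} ->
  ((dint (fun x => step c X x ^+ 2 * v x) J)%:E <=
   \int[mu]_(x in dset J) (step_series D c x ^+ 2 * (v x)%:E))%E.
Proof.
move=> pv c0 uX XD; rewrite -integral_step_sq//.
have [mv v0 Iv] := pv.
apply: ge0_le_integral => //.
- exact: measurable_dset.
- by move=> x _; rewrite lee_fin mulr_ge0 ?sqr_ge0// ltW.
- apply/measurable_EFinP; apply: (@measurable_funS _ _ _ _ setT) => //.
  apply: measurable_funM => //; apply: measurable_funX.
  exact: measurable_step.
- apply: (@measurable_funS _ _ _ _ setT) => //.
  apply: emeasurable_funM; last exact/measurable_EFinP.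
  under eq_fun do rewrite expe2.
  by apply: emeasurable_funM; exact: measurable_step_series.
- move=> x _; rewrite EFinM EFin_expe lee_wpmul2r//; first by rewrite lee_fin ltW.
  rewrite lee_sqr ?lee_fin ?step_ge0 ?step_series_ge0//.
  exact: step_le_series.
Qed.

Lemma dint_step_sq_le (lam : dyadic -> R) (v w f : R -> R) (B P : R) X J :
  pos_weight v -> (forall I, 0 <= lam I) -> sq_bounded lam v w B ->
  measurable_fun setT f -> (forall x, 0 <= f x) ->
  (\int[mu]_x (f x ^+ 2 * (w x)^-1)%:E = P%:E)%E -> uniq X ->
  dint (fun x => step (fun I => lam I * dint f I) X x ^+ 2 * v x) J <= B * P.
Proof.
move=> pv lam0 bd mf f0 fP uX; have [mv v0 Iv] := pv.
have c0 I : 0 <= lam I * dint f I by rewrite mulr_ge0// dint_ge0.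
have := bd f mf f0; rewrite fP => /(_ (ltry _)); rewrite -EFinM => le1.
rewrite -lee_fin; apply: le_trans le1.
apply: le_trans (@integral_step_sq_le_series setT _ v X J pv c0 uX _) _ => //.
apply: ge0_subset_integral => //; first exact: measurable_dset.
- apply: emeasurable_funM; last exact/measurable_EFinP.
  under eq_fun do rewrite expe2.
  by apply: emeasurable_funM; exact: measurable_step_series.
- by move=> x _; rewrite mule_ge0 ?sqre_ge0// lee_fin ltW.
Qed.

(** The argument is [w chi_J], whose squared norm in [L^2(1/w)] is the integral
    of [w] over [J]. *)
Lemma sq_bounded_testing (lam : dyadic -> R) (v w : R -> R) (B : R) X J :
  pos_weight v -> pos_weight w -> (forall I, 0 <= lam I) ->
  sq_bounded lam v w B -> uniq X -> {in X, forall I, dset I `<=` dset J} ->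
  dint (fun x => step (fun I => lam I * dint w I) X x ^+ 2 * v x) J
    <= B * dint w J.
Proof.
move=> pv pw lam0 bd uX XJ; have [mw w0 Iw] := pw.
pose f x := w x * \1_(dset J) x.
have mf : measurable_fun setT f.
  apply: measurable_funM => //.
  by apply: measurable_indic; exact: measurable_dset.
have f0 x : 0 <= f x by rewrite /f mulr_ge0 ?indicE// ltW.
have fE x : dset J x -> f x = w x by move=> Jx; rewrite /f indicE mem_set// mulr1.
have fP : (\int[mu]_x (f x ^+ 2 * (w x)^-1)%:E = (dint w J)%:E)%E.
  rewrite (@integral_dset _ _ J); last first.
  - by move=> x xJ; rewrite /f indicE memNset// mulr0 expr0n mul0r.
  - apply: (@dintegrable_dom _ _ w _ 1) => //; first exact: measurable_sq_div.
    move=> x Jx; rewrite fE// mul1r expr2 mulfK ?gt_eqF// ger0_norm//.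
    exact: ltW.
  congr EFin; apply: eq_Rintegral => x; rewrite inE => Jx.
  by rewrite fE// expr2 mulfK// gt_eqF.
have := @dint_step_sq_le lam v w f B _ X J pv lam0 bd mf f0 fP uX.
rewrite (_ : (fun x => _) = (fun x : R =>
  step (fun I => lam I * dint w I) X x ^+ 2 * v x))//.
apply/funext => x; congr (_ ^+ 2 * _); apply: eq_big_seq => I XI.
congr (_ * _ * _); apply: eq_Rintegral => y; rewrite inE => Iy.
by rewrite fE//; exact: XJ Iy.
Qed.

(** With [S] the step function on the left and [h = S w], the squared norm of
    [h] in [L^2(1/w)] is the left side [N] itself.  The symmetry of the form
    writes [N] as the integral over [J] of [v] times the step function built
    from [h]; the square of the latter is controlled by [B N], and completing a
    square leaves [2 B N <= B^2 (int_J v) + B N]. *)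
Lemma sq_bounded_dual_testing (lam : dyadic -> R) (v w : R -> R) (B : R) X J :
  pos_weight v -> pos_weight w -> (forall I, 0 <= lam I) -> 0 < B ->
  sq_bounded lam v w B -> uniq X -> {in X, forall I, dset I `<=` dset J} ->
  dint (fun x => step (fun I => lam I * dint v I) X x ^+ 2 * w x) J
    <= B * dint v J.
Proof.
move=> pv pw lam0 B0 bd uX XJ.
have [mv v0 Iv] := pv; have [mw w0 Iw] := pw.
have v0' x : 0 <= v x by exact: ltW.
have w0' x : 0 <= w x by exact: ltW.
pose c I := lam I * dint v I.
have c0 I : 0 <= c I by rewrite mulr_ge0// dint_ge0.
pose S := step c X.
have S0 x : 0 <= S x by exact: step_ge0.
have mS : measurable_fun setT S by exact: measurable_step.
pose h x := S x * w x.
have mh : measurable_fun setT h by exact: measurable_funM.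
have h0 x : 0 <= h x by rewrite mulr_ge0.
have Ih I : dintegrable I h by exact: dintegrable_step.
set N := dint _ J.
have hP : (\int[mu]_x (h x ^+ 2 * (w x)^-1)%:E = N%:E)%E.
  rewrite -(@integral_dset _ _ J); first last.
  - move=> x xJ; rewrite /step big_seq big1 ?expr0n ?mul0r// => I XI.
    by rewrite indicE memNset ?mulr0// => /(XJ _ XI).
  - exact: dintegrable_step_sq.
  by apply: eq_integral => x _; congr EFin; rewrite /h /S -/c; field; rewrite gt_eqF.
pose d I := lam I * dint h I.
have d0 I : 0 <= d I by rewrite mulr_ge0// dint_ge0.
have le1 := @dint_step_sq_le lam v w h B _ X J pv lam0 bd mh h0 hP uX.
have NE : N = dint (fun x => step d X x * v x) J.
  rewrite dint_step//.
  have -> : N = dint (fun x => S x * h x) J.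
    by congr Rintegral; apply/funext => x; rewrite /h /S -/c; ring.
  by rewrite dint_step//; apply: eq_bigr => I _; rewrite /c /d; ring.
have le2 : dint (fun x => 2%:R * B * (step d X x * v x)) J <=
    dint (fun x => B ^+ 2 * v x + step d X x ^+ 2 * v x) J.
  apply: le_dint.
  - by apply: dintegrableZ; exact: dintegrable_step.
  - rewrite /dintegrable; under [X in _.-integrable _ X]eq_fun do rewrite EFinD.
    apply: integrableD; [exact: measurable_dset|exact: dintegrableZ|].
    exact: dintegrable_step_sq.
  move=> x _; rewrite mulrA -mulrDl ler_wpM2r//.
  by have := sqr_ge0 (B - step d X x); lra.
move: le2; rewrite dintZ; last exact: dintegrable_step.
rewrite dintD; [|exact: dintegrableZ|exact: dintegrable_step_sq].
rewrite dintZ// -NE -/d => le2.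
rewrite -(ler_pM2l B0).
by move: le1 le2; rewrite -/d; lra.
Qed.

End Necessity.

(** * The operator T0 for everywhere positive weights *)

Section Operator.
Context {R : realType}.
Local Notation mu := (@lebesgue_measure R).
Local Notation dset := (@dyadic_set R).

Definition T0_coef (v w : R -> R) (I : dyadic) : R :=
  alpha v w I / dyadic_length I ^+ 2.

Lemma T0_coef_ge0 (v w : R -> R) I : 0 <= T0_coef v w I.
Proof.
have L0 := @dyadic_length_gt0 R I.
by rewrite divr_ge0 ?sqr_ge0// !mulr_ge0// ltW.
Qed.

(** This symmetry is what makes the second condition the first one with [v] and
    [w] exchanged. *)
Lemma T0_coefC (v w : R -> R) : T0_coef v w = T0_coef w v.
Proof. by apply/funext => I; congr (_ * _ / _); exact: mulrC. Qed.

Lemma T0_termE (v w f : R -> R) I x :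
  T0_term v w f I x = T0_coef v w I * dint f I * \1_(dset I) x.
Proof.
rewrite /T0_term avgE /T0_coef; congr (_ * _).
by field; rewrite gt_eqF ?dyadic_length_gt0.
Qed.

Lemma local_sumE (v w g : R -> R) J x : local_sum v w g J x =
  step_series [set I | dset I `<=` dset J] (fun I => T0_coef v w I * dint g I) x.
Proof. by apply: eq_esum => I _; rewrite T0_termE. Qed.

Lemma local_sumC (v w g : R -> R) : local_sum v w g = local_sum w v g.
Proof.
by apply/funext => J; apply/funext => x; rewrite !local_sumE (T0_coefC v w).
Qed.

Lemma le_avg_iff (X : \bar R) (C : R) (w : R -> R) J :
  (((dyadic_length J)^-1%:E * X <= (C * avg w J)%:E)%E)
  <-> (X <= (C * dint w J)%:E)%E.
Proof.
have L0 : 0 < (dyadic_length J)^-1 :> R by rewrite invr_gt0 dyadic_length_gt0.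
by rewrite avgE mulrCA (EFinM _^-1) lee_pmul2l.
Qed.

Lemma testing_of_local_sum (v w : R -> R) (C : R) :
  pos_weight v -> pos_weight w ->
  (forall J : dyadic, ((dyadic_length J)^-1%:E
         * \int[mu]_(x in dset J) (local_sum v w w J x ^+ 2 * (v x)%:E)
       <= (C * avg w J)%:E)%E) ->
  testing (T0_coef v w) v w C.
Proof.
move=> pv pw h n J; have [mw w0 Iw] := pw.
move/(_ J)/le_avg_iff : h; under eq_integral do rewrite local_sumE.
rewrite -lee_fin /energy; apply: le_trans.
under [X in (dint X _)%:E]eq_fun do rewrite add0r.
apply: integral_step_sq_le_series => //.
- by move=> I; rewrite mulr_ge0 ?T0_coef_ge0// dint_ge0// => x; exact: ltW.
- exact: tree_uniq.
- by move=> I; exact: tree_sub.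
Qed.

Lemma local_sum_le (v w g u : R -> R) (C : R) :
  pos_weight u -> (forall x, 0 <= g x) ->
  (forall J X, uniq X -> {in X, forall I, dset I `<=` dset J} ->
    dint (fun x => step (fun I => T0_coef v w I * dint g I) X x ^+ 2 * u x) J
      <= C * dint g J) ->
  forall J : dyadic, ((dyadic_length J)^-1%:E
         * \int[mu]_(x in dset J) (local_sum v w g J x ^+ 2 * (u x)%:E)
       <= (C * avg g J)%:E)%E.
Proof.
move=> pu g0 h J; apply/le_avg_iff; under eq_integral do rewrite local_sumE.
have [mu' u0 Iu] := pu.
have c0 I : 0 <= T0_coef v w I * dint g I by rewrite mulr_ge0 ?T0_coef_ge0 ?dint_ge0.
apply: integral_step_series_sq_le => //.
- by move=> x; exact: ltW.
- exact: measurable_dset.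
- by move=> X uX XJ; rewrite integral_step_sq// lee_fin; exact: h.
Qed.

Lemma T0_ge0E (v w f : R -> R) x : (forall x, 0 <= f x) ->
  T0 v w f x = step_series setT (fun I => T0_coef v w I * dint f I) x.
Proof.
move=> f0.
have t0 I : (0 <= (T0_term v w f I x)%:E)%E.
  by rewrite T0_termE lee_fin mulr_ge0 ?indicE// mulr_ge0 ?T0_coef_ge0 ?dint_ge0.
rewrite /T0 [X in (_ - X)%E]esum1 ?sube0.
  apply: eq_esum => I _; rewrite -T0_termE.
  by rewrite (@ge0_funeposE _ _ setT)// ?inE.
by move=> I _; rewrite (@ge0_funenegE _ _ setT)// ?inE.
Qed.

Lemma measurable_T0 (v w f : R -> R) : measurable_fun setT (T0 v w f).
Proof.
have mt I : measurable_fun setT (T0_term v w f I).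
  apply: measurable_funM => //.
  by apply: measurable_indic; exact: measurable_dset.
apply: emeasurable_funB.
  under eq_fun => x do under eq_esum => I _ do rewrite funeposE -EFin_max.
  apply: measurable_esum => [I x|I]; first by rewrite le_max lexx orbT.
  exact: measurable_maxr.
under eq_fun => x do under eq_esum => I _ do rewrite funenegE -EFinN -EFin_max.
apply: measurable_esum => [I x|I]; first by rewrite le_max lexx orbT.
by apply: measurable_maxr => //; exact: measurableT_comp.
Qed.

Lemma abs_T0_term_le (v w f : R -> R) I x : measurable_fun setT f ->
  dintegrable I (fun x => `|f x|) ->
  `|T0_term v w f I x|
    <= T0_coef v w I * dint (fun x => `|f x|) I * \1_(dset I) x.
Proof.
move=> mf If; rewrite T0_termE 2!normrM (ger0_norm (T0_coef_ge0 _ _ _)).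
rewrite (@ger0_norm _ (\1_(dset I) x)) ?indicE//.
rewrite ler_wpM2r// ler_wpM2l ?T0_coef_ge0//.
apply: le_normr_Rintegral; first exact: measurable_dset.
by apply: (@dintegrable_dom _ _ _ _ 1 mf If) => y _; rewrite mul1r.
Qed.

(** The positive and the negative part of the series are both dominated by the
    series of [|f|], hence so is their difference, even where both diverge. *)
Lemma abs_T0_le (v w f : R -> R) x : measurable_fun setT f ->
  (forall I, dintegrable I (fun x => `|f x|)) ->
  (`|T0 v w f x| <=
    step_series setT
      (fun I => (T0_coef v w I * dint (fun x => `|f x|) I)%R) x)%E.
Proof.
move=> mf If.
set S := step_series _ _ _; rewrite /T0; set a := esum _ _; set b := esum _ _.
have a0 : (0 <= a)%E by apply: esum_ge0 => I _; exact: funepos_ge0.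
have b0 : (0 <= b)%E by apply: esum_ge0 => I _; exact: funeneg_ge0.
have aS : (a <= S)%E.
  apply: le_esum => I _; rewrite funeposE -EFin_max lee_fin ge_max.
  by have := abs_T0_term_le v w f I x mf (If I); rewrite ler_norml; lra.
have bS : (b <= S)%E.
  apply: le_esum => I _; rewrite funenegE -EFinN -EFin_max lee_fin ge_max.
  by have := abs_T0_term_le v w f I x mf (If I); rewrite ler_norml; lra.
move: a b S a0 b0 aS bS => [a||] [b||] [S||]//=; rewrite ?leey// !lee_fin ler_norml.
by lra.
Qed.

Lemma poweR_half_le (a : \bar R) (b C : R) : (0 <= a)%E -> 0 <= b ->
  (a `^ 2^-1 <= C%:E * b%:E `^ 2^-1)%E -> (a <= (C ^+ 2 * b)%:E)%E.
Proof.
move=> a0 b0; rewrite !poweR12_sqrt// /=; case: a a0 => [a||]//=.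
rewrite -EFinM !lee_fin => a0 h.
rewrite -(sqr_sqrtr a0) -[X in _ * X](sqr_sqrtr b0) -exprMn.
by rewrite ler_pXn2r ?nnegrE ?sqrtr_ge0//; exact: le_trans h.
Qed.

Lemma le_poweR_half (a : \bar R) (b B : R) : (0 <= a)%E -> 0 <= b -> 0 <= B ->
  (a <= (B * b)%:E)%E ->
  (a `^ 2^-1 <= (Num.sqrt B)%:E * b%:E `^ 2^-1)%E.
Proof.
move=> a0 b0 B0; rewrite !poweR12_sqrt// /=; case: a a0 => [a||]//=.
by rewrite !lee_fin => a0 h; rewrite -sqrtrM// ler_sqrt// mulr_ge0.
Qed.

Lemma sq_bounded_of_T0_bounded (v w : R -> R) : pos_weight v -> pos_weight w ->
  T0_bounded v w -> exists2 B : R, 0 < B & sq_bounded (T0_coef v w) v w B.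
Proof.
move=> [mv v0 Iv] [mw w0 Iw] [C hC]; exists (C ^+ 2 + 1).
  by have := sqr_ge0 C; lra.
move=> f mf f0 fin.
set P := (\int[mu]_x _)%E in fin *.
have P0 : (0 <= P)%E.
  apply: integral_ge0 => x _; rewrite lee_fin mulr_ge0 ?sqr_ge0//.
  by rewrite invr_ge0 ltW.
have PE : (P = \int[mu]_x (`|(EFin \o f) x| ^+ 2 * ((w x)^-1)%:E))%E.
  by apply: eq_integral => x _; rewrite /= ger0_norm// EFinM EFin_expe.
have L2f : L2 (fun x => (w x)^-1) (EFin \o f).
  split; first exact/measurable_EFinP.
  by rewrite /L2norm -PE poweR_lty.
have [_ _] := hC f L2f; rewrite /L2norm -PE.
have Pfin : P \is a fin_num by rewrite ge0_fin_numE.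
pose S := step_series setT (fun I => T0_coef v w I * dint f I).
have S0 x : (0 <= S x)%E.
  by apply: step_series_ge0 => I; rewrite mulr_ge0 ?T0_coef_ge0 ?dint_ge0.
have -> : (\int[mu]_x (`|T0 v w f x| ^+ 2 * (v x)%:E) =
    \int[mu]_x (S x ^+ 2 * (v x)%:E))%E.
  by apply: eq_integral => x _; rewrite T0_ge0E// gee0_abs.
have P0' : 0 <= fine P by exact: fine_ge0.
rewrite -(fineK Pfin) => /poweR_half_le h; apply: le_trans (h _ P0') _.
  by apply: integral_ge0 => x _; rewrite mule_ge0 ?expe_ge0// lee_fin ltW.
by rewrite -EFinM lee_fin ler_wpM2r// lerDl.
Qed.

(** A signed [f] is handled through [|f|]: the series of [|f|] has finite norm
    in [L^2(v)] with [v > 0], so it converges almost everywhere, and it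
    dominates [T0 f]. *)
Lemma T0_bounded_of_sq_bounded (v w : R -> R) (B : R) :
  pos_weight v -> pos_weight w ->
  0 <= B -> sq_bounded (T0_coef v w) v w B -> T0_bounded v w.
Proof.
move=> pv pw B0 bd.
have [mv v0 Iv] := pv; have [mw w0 Iw] := pw.
exists (Num.sqrt B) => f [/measurable_EFinP mf nf].
pose g x := `|f x|.
have mg : measurable_fun setT g by exact: measurableT_comp.
have g0 x : 0 <= g x by exact: normr_ge0.
pose P := (\int[mu]_x (g x ^+ 2 * (w x)^-1)%:E)%E.
have P0 : (0 <= P)%E.
  apply: integral_ge0 => x _; rewrite lee_fin mulr_ge0 ?sqr_ge0//.
  by rewrite invr_ge0 ltW.
have PE : (\int[mu]_x (`|(EFin \o f) x| ^+ 2 * ((w x)^-1)%:E) = P)%E.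
  by apply: eq_integral => x _; rewrite /= EFinM EFin_expe.
have Plty : (P < +oo)%E.
  by move: nf; rewrite /L2norm PE; apply: lty_poweRy.
have Pfin : P \is a fin_num by rewrite ge0_fin_numE.
have Ig I : dintegrable I g.
  apply: (dintegrable_of_sq w) => //; apply: dintegrable_of_lty => //.
    exact: measurable_sq_div.
  by move=> x; rewrite mulr_ge0 ?sqr_ge0// invr_ge0 ltW.
pose c I := T0_coef v w I * dint g I.
have c0 I : 0 <= c I by rewrite mulr_ge0 ?T0_coef_ge0 ?dint_ge0.
pose S := step_series setT c.
have S0 x : (0 <= S x)%E by exact: step_series_ge0.
have mS : measurable_fun setT S by exact: measurable_step_series.
have mS2v : measurable_fun setT (fun x => S x ^+ 2 * (v x)%:E)%E.
  apply: emeasurable_funM; last exact/measurable_EFinP.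
  by under eq_fun do rewrite expe2; exact: emeasurable_funM.
have S2v0 x : (0 <= S x ^+ 2 * (v x)%:E)%E.
  by rewrite mule_ge0 ?expe_ge0// lee_fin ltW.
have TS x : (`|T0 v w f x| <= S x)%E by exact: abs_T0_le.
have le1 : (\int[mu]_x (S x ^+ 2 * (v x)%:E) <= (B * fine P)%:E)%E.
  by rewrite EFinM fineK//; exact: bd.
have le2 : (\int[mu]_x (`|T0 v w f x| ^+ 2 * (v x)%:E) <= (B * fine P)%:E)%E.
  apply: le_trans le1; apply: ge0_le_integral => //.
  - by move=> x _; rewrite mule_ge0 ?expe_ge0// lee_fin ltW.
  - apply: emeasurable_funM; last exact/measurable_EFinP.
    under eq_fun do rewrite expe2.
    by apply: emeasurable_funM; apply: measurableT_comp => //; exact: measurable_T0.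
  - move=> x _; rewrite lee_wpmul2r//; first by rewrite lee_fin ltW.
    by rewrite lee_sqr.
have le3 : (L2norm v (T0 v w f) <=
    (Num.sqrt B)%:E * L2norm (fun x => (w x)^-1%R) (EFin \o f))%E.
  rewrite /L2norm PE -(fineK Pfin); apply: le_poweR_half => //.
  - apply: integral_ge0 => x _.
    by rewrite mule_ge0 ?expe_ge0// lee_fin ltW.
  - exact: fine_ge0.
split=> //; last first.
  split; first exact: measurable_T0.
  by rewrite poweR_lty// (le_lt_trans le2)// ltry.
have IS : mu.-integrable setT (fun x => S x ^+ 2 * (v x)%:E)%E.
  apply/integrableP; split => //.
  under eq_integral do rewrite gee0_abs//.
  by rewrite (le_lt_trans le1)// ltry.
have := @integrable_ae _ _ _ mu setT measurableT _ IS.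
apply: filterS => x /(_ I) Sfin.
have {}Sfin : (S x < +oo)%E.
  rewrite ltNge leye_eq; apply/negP => /eqP Sx.
  by move: Sfin; rewrite Sx expe2 mulyy mulyr gtr0_sg// mul1e.
apply: le_lt_trans Sfin; apply: le_esum => I _.
by rewrite /= lee_fin; exact: abs_T0_term_le.
Qed.

Lemma T0_bounded_iff_testing (v w : R -> R) : pos_weight v -> pos_weight w ->
  T0_bounded v w <->
  exists C : R,
    (forall J : dyadic,
      ((dyadic_length J)^-1%:E
         * \int[mu]_(x in dset J) (local_sum v w w J x ^+ 2 * (v x)%:E)
       <= (C * avg w J)%:E)%E) /\
    (forall J : dyadic,
      ((dyadic_length J)^-1%:E
         * \int[mu]_(x in dset J) (local_sum v w v J x ^+ 2 * (w x)%:E)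
       <= (C * avg v J)%:E)%E).
Proof.
move=> pv pw; have [mv v0 Iv] := pv; have [mw w0 Iw] := pw; split.
  move=> /(sq_bounded_of_T0_bounded _ _ pv pw)[B B0 bd].
  exists B; split; apply: local_sum_le => //.
  - by move=> x; exact: ltW.
  - by move=> J X uX XJ; apply: sq_bounded_testing => // I; exact: T0_coef_ge0.
  - by move=> x; exact: ltW.
  - move=> J X uX XJ; apply: sq_bounded_dual_testing => // I.
    exact: T0_coef_ge0.
move=> [C [h1 h2]].
have t1 := testing_of_local_sum v w C pv pw h1.
rewrite (local_sumC v w) in h2.
have t2 := testing_of_local_sum w v C pw pv h2.
rewrite (T0_coefC w v) in t2.
have t0 := sq_bounded_of_testing _ _ _ _ pv pw (T0_coef_ge0 v w) t1 t2.
by apply: T0_bounded_of_sq_bounded t0 => //; rewrite mulr_ge0// sqr_ge0.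
Qed.

End Operator.

(** * Null sets *)

Section AlmostEverywhere.
Context {R : realType}.
Local Notation mu := (@lebesgue_measure R).
Local Notation dset := (@dyadic_set R).

Lemma ae_imp (P Q : R -> Prop) : (forall x, P x -> Q x) ->
  {ae mu, forall x, P x} -> {ae mu, forall x, Q x}.
Proof.
by move=> PQ; apply: filterS; first exact: (ae_filter_ringOfSetsType mu).
Qed.

(** Measurability is included because equality of integrals of functions that
    agree almost everywhere requires it. *)
Definition same_weight (v v' : R -> R) : Prop :=
  [/\ measurable_fun setT v, measurable_fun setT v'
    & {ae mu, forall x, v x = v' x}].

Lemma same_weight_sym v v' : same_weight v v' -> same_weight v' v.
Proof. by move=> [mv mv' e]; split=> //; move: e; apply: ae_imp => x ->. Qed.

Lemma same_weight_inv v v' : same_weight v v' ->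
  same_weight (fun x => (v x)^-1) (fun x => (v' x)^-1).
Proof.
by move=> [mv mv' e]; split; [exact: measurable_inv..|];
  move: e; apply: ae_imp => x ->.
Qed.

Lemma same_weight_integral v v' (F : R -> \bar R) (E : set R) :
  same_weight v v' -> measurable E -> measurable_fun setT F ->
  (\int[mu]_(x in E) (F x * (v x)%:E) = \int[mu]_(x in E) (F x * (v' x)%:E))%E.
Proof.
move=> [mv mv' e] mE mF; apply: ae_eq_integral => //.
- apply: (@measurable_funS _ _ _ _ setT) => //.
  by apply: emeasurable_funM => //; exact/measurable_EFinP.
- apply: (@measurable_funS _ _ _ _ setT) => //.
  by apply: emeasurable_funM => //; exact/measurable_EFinP.
- by move: e; apply: ae_imp => x -> _.
Qed.

Lemma same_weight_dint v v' : same_weight v v' -> dint v = dint v'.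
Proof.
move=> e; apply/funext => J; congr fine.
have E u : (\int[mu]_(x in dset J) (u x)%:E
    = \int[mu]_(x in dset J) (1 * (u x)%:E))%E.
  by apply: eq_integral => x _; rewrite mul1e.
rewrite (E v) (E v'); apply: (same_weight_integral v v' (cst 1%E)) => //.
exact: measurable_dset.
Qed.

Lemma same_weight_avg v v' : same_weight v v' -> avg v = avg v'.
Proof.
by move=> e; apply/funext => J; rewrite !avgE (same_weight_dint v v' e).
Qed.

Lemma same_weight_T0_term v v' w w' : same_weight v v' -> same_weight w w' ->
  T0_term v w = T0_term v' w'.
Proof.
move=> ev ew; apply/funext => f; apply/funext => I; apply/funext => x.
by rewrite /T0_term /alpha (same_weight_avg v v' ev) (same_weight_avg w w' ew).
Qed.

Lemma same_weight_T0 v v' w w' : same_weight v v' -> same_weight w w' ->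
  T0 v w = T0 v' w'.
Proof. by move=> ev ew; rewrite /T0 (same_weight_T0_term v v' w w'). Qed.

Lemma measurable_abse_sq (F : R -> \bar R) : measurable_fun setT F ->
  measurable_fun setT (fun x => `|F x| ^+ 2)%E.
Proof.
move=> mF; under eq_fun do rewrite expe2.
by apply: emeasurable_funM; exact: measurableT_comp.
Qed.

Lemma same_weight_L2norm v v' (F : R -> \bar R) : same_weight v v' ->
  measurable_fun setT F -> L2norm v F = L2norm v' F.
Proof.
move=> e mF; rewrite /L2norm (same_weight_integral v v' _ _ e)//.
exact: measurable_abse_sq.
Qed.

Lemma same_weight_T0_bounded v v' w w' :
  same_weight v v' -> same_weight w w' -> T0_bounded v w -> T0_bounded v' w'.
Proof.
move=> ev ew [C hC]; exists C => f [mf nf].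
have ewi := same_weight_inv w w' ew.
rewrite -(same_weight_L2norm _ _ _ ewi)// in nf.
have mT := measurable_T0 v' w' f.
have [] := hC f (conj mf nf).
rewrite /T0_summable (same_weight_T0_term v v' w w' ev ew).
rewrite (same_weight_T0 v v' w w' ev ew) /L2.
by rewrite (same_weight_L2norm v v' _ ev)// (same_weight_L2norm _ _ _ ewi).
Qed.

Lemma pos_weight_version (v : R -> R) : weight v ->
  exists2 v' : R -> R, pos_weight v' & same_weight v v'.
Proof.
move=> [[mv _ lv] v0].
pose v' x := if 0 < v x then v x else 1.
have mv' : measurable_fun setT v'.
  by apply: measurable_fun_ifT => //; exact: measurable_fun_ltr.
have e : same_weight v v'.
  by split=> //; move: v0; apply: ae_imp => x vx; rewrite /v' vx.
exists v' => //; split=> //; first by move=> x; rewrite /v'; case: ifPn.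
move=> J; apply/integrableP; split.
  by apply/measurable_EFinP; exact: measurable_funS mv'.
pose K : set R :=
  `[J.2%:~R * dyadic_length J, (J.2 + 1)%:~R * dyadic_length J]%classic.
have JK : dset J `<=` K.
  by move=> x; rewrite /dyadic_set /K /= !in_itv /= => /andP[-> /ltW].
have := lv K (@subsetT _ _) (@segment_compact _ _ _).
apply: le_lt_trans; rewrite (_ : (\int[mu]_(x in dset J) _ =
    \int[mu]_(x in dset J) `|v x|%:E)%E); last first.
  apply: ae_eq_integral; first exact: measurable_dset.
  - apply/measurable_EFinP; apply: (@measurable_funS _ _ _ _ setT) => //.
    exact: measurableT_comp.
  - apply/measurable_EFinP; apply: (@measurable_funS _ _ _ _ setT) => //.
    exact: measurableT_comp.
  - by move: v0; apply: ae_imp => x vx _ /=; rewrite /v' vx.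
apply: ge0_subset_integral => //; 
  [exact: measurable_dset|exact: measurable_itv|].
apply/measurable_EFinP; apply: (@measurable_funS _ _ _ _ setT) => //.
exact: measurableT_comp.
Qed.

Lemma same_weight_testing v v' w w' g g' u u' C :
  pos_weight g' -> same_weight v v' -> same_weight w w' -> same_weight g g' ->
  same_weight u u' -> forall J : dyadic,
  ((dyadic_length J)^-1%:E
       * \int[mu]_(x in dset J) (local_sum v w g J x ^+ 2 * (u x)%:E)
     <= (C * avg g J)%:E)%E =
  ((dyadic_length J)^-1%:E
       * \int[mu]_(x in dset J) (local_sum v' w' g' J x ^+ 2 * (u' x)%:E)
     <= (C * avg g' J)%:E)%E.
Proof.
move=> [_ g0 _] ev ew eg eu J.
have -> : local_sum v w g = local_sum v' w' g'.
  apply/funext => K; apply/funext => x; rewrite !local_sumE /T0_coef /alpha.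
  by rewrite (same_weight_avg v v' ev) (same_weight_avg w w' ew)
             (same_weight_dint g g' eg).
rewrite (same_weight_avg g g' eg) (same_weight_integral u u' _ _ eu)//.
  exact: measurable_dset.
under eq_fun do rewrite local_sumE expe2.
have c0 I : 0 <= T0_coef v' w' I * dint g' I.
  by rewrite mulr_ge0 ?T0_coef_ge0 ?dint_ge0// => x; exact: ltW.
by apply: emeasurable_funM; exact: measurable_step_series.
Qed.

End AlmostEverywhere.

Theorem theorem0p3 (R : realType) (v w : R -> R) (hv : weight v)
    (hw : weight w) :
  T0_bounded v w <->
  exists C : R,
    (forall J : dyadic,
      ((dyadic_length J)^-1%:E
         * \int[lebesgue_measure]_(x in dyadic_set J)
             (local_sum v w w J x ^+ 2 * (v x)%:E)
       <= (C * avg w J)%:E)%E) /\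
    (forall J : dyadic,
      ((dyadic_length J)^-1%:E
         * \int[lebesgue_measure]_(x in dyadic_set J)
             (local_sum v w v J x ^+ 2 * (w x)%:E)
       <= (C * avg v J)%:E)%E).
Proof.
have [v' pv ev] := pos_weight_version v hv.
have [w' pw ew] := pos_weight_version w hw.
have h1 C J := same_weight_testing v v' w w' w w' v v' C pw ev ew ew ev J.
have h2 C J := same_weight_testing v v' w w' v v' w w' C pv ev ew ev ew J.
split.
  move/(same_weight_T0_bounded _ _ _ _ ev ew).
  move/(T0_bounded_iff_testing v' w' pv pw) => [C [t1 t2]].
  by exists C; split => J; [rewrite h1; exact: t1|rewrite h2; exact: t2].
move=> [C [t1 t2]].
apply: (same_weight_T0_bounded _ _ _ _ (same_weight_sym _ _ ev)
                                       (same_weight_sym _ _ ew)).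
apply/(T0_bounded_iff_testing v' w' pv pw).
by exists C; split => J; [rewrite -h1; exact: t1|rewrite -h2; exact: t2].
Qed.
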